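(* Let $n>2$ be an integer. Let $k'$ be the integer such that $2n+1=k'3^{u}$ with $u\ge 0$ an integer and $\gcd(k',3)=1$, and let $k''$ be the integer such that $(2n+1)(2n-1)=k''3^{u'}5^{v'}$ with $u',v'\ge 0$ integers and $\gcd(k'',15)=1$. Suppose $k''<k'$. If $a_n=k''$ and $a_0=1$, then there exist integers $a_{n-1},a_{n-2},\dots,a_1$ for which the polynomial \[ f(x)=\sum_{j=0}^{n}a_j\frac{x^{2j}}{u_{2j+2}} \] has the quartic factor $x^4-5x^2-15$, which is irreducible over $\mathbb{Q}$.
   Context: For $j\ge 0$, $u_{2j+2}=1\times 3\times 5\times\cdots\times(2j+1)$ is the product of the odd positive integers up to $2j+1$ (so $u_2=1$, $u_4=3$, $u_6=15$). ''Factor'' means divisor in $\mathbb{Q}[x]$. *)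

(* Defs.v *)
From HB Require Import structures.
From mathcomp Require Import all_boot all_order all_algebra.

Set Implicit Arguments.
Unset Strict Implicit.
Unset Printing Implicit Defensive.

Import Order.TTheory GRing.Theory Num.Theory.
Local Open Scope ring_scope.

(* u m is the product of the odd numbers below m, so that
   u (2j+2) = 1 * 3 * ... * (2j+1). *)
Definition u (m : nat) : nat := (\prod_(0 <= i < m | odd i) i)%N.

(* Only the values a 0, ..., a n matter. *)
Definition f (n : nat) (a : nat -> int) : {poly rat} :=
  \sum_(j < n.+1) ((a j)%:~R / (u (2 * j + 2)%N)%:R) *: 'X^(2 * j)%N.

Definition quartic : {poly rat} := 'X^4 - 5%:R *: 'X^2 - 15%:R%:P.

(* Main.v *)
Require Import Defs.
From mathcomp Require Import all_boot all_order all_algebra.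
From mathcomp Require Import zify ring.

Import Order.TTheory GRing.Theory Num.Theory.
Local Open Scope ring_scope.

(* The quartic is Eisenstein at 5.  For the divisibility, write t for the class
   of x^2, so that t^2 = 5 t + 15, and U_j = u (2 j + 2).  One needs
   1 + k'' t^n / U_n in the Z-span L of the t^j / U_j, 0 < j < n.  Since
   1 = t^2 / 15 - t / 3 is in L, it suffices that k'' lies in the ideal I of the
   integers c with c t^n / U_n in L.  The recurrence puts
   (2 n + 1) (2 n - 1) = k'' 3^e' 5^v' in I, so it is enough to find in I an
   element prime to 5 and an element prime to 3.
   - 5 is ramified: 5^(n/2) divides t^n in Z[t], and v_5(U_n) <= n / 2.
   - Writing t^m = A_m t + B_m, one has A_{n-1} t^n - A_n t^{n-1} = +- 15^(n-1),
     where 3 does not divide A_{n-1} and v_3(U_{n-1}) <= n - 1.  This gives an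
     element A_{n-1} r (2 n + 1) of I with r prime to 3; the assumption k'' < k'
     forces 3 not to divide 2 n + 1. *)

(** * Irreducibility of the quartic *)

Lemma quartic_irreducible : irreducible_poly quartic.
Proof.
pose q : {poly int} := Poly [:: -15; 0; -5; 0; 1].
have qs : q = [:: -15; 0; -5; 0; 1] :> seq int by rewrite (PolyK (c := 1)).
have -> : quartic = map_poly (intr : int -> rat) q.
  apply/polyP => i; rewrite coef_map qs /quartic !coefE.
  by case: i => [|[|[|[|[|i]]]]] //=; rewrite ?nth_nil /=; ring.
apply/irreducible_rat_int/(@eisenstein_crit 5); rewrite // ?lead_coefE ?qs //.
by case=> [|[|[|[|i]]]].
Qed.

(** * Valuations of the products of odd numbers *)

Lemma u_double (N : nat) : u (2 * N) = (\prod_(0 <= j < N) (2 * j + 1))%N.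
Proof.
elim: N => [|N IH]; first by rewrite /u muln0 !big_geq.
rewrite big_nat_recr //= -IH /u mulnS add2n.
rewrite big_mkcond /= !big_nat_recr //= -big_mkcond /=.
rewrite mul2n odd_double /= muln1.
by rewrite addn1.
Qed.

Lemma u_doubleSS (j : nat) : u (2 * j.+1 + 2) = (u (2 * j + 2) * (2 * j + 3))%N.
Proof.
have e k : (2 * k + 2 = 2 * k.+1)%N by lia.
by rewrite !e !u_double big_nat_recr //=; congr muln; lia.
Qed.

Lemma u_double_gt0 (N : nat) : (0 < u (2 * N))%N.
Proof. by rewrite u_double prodn_gt0 // => j; rewrite addn1. Qed.

Lemma logn_u_double (p N : nat) :
  logn p (u (2 * N)) = (\sum_(0 <= j < N) logn p (2 * j + 1))%N.
Proof.
elim: N => [|N IH]; first by rewrite /u muln0 !big_geq // logn1.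
rewrite u_double !big_nat_recr //= -u_double lognM ?u_double_gt0 ?addn1 //.
by rewrite IH.
Qed.

(* With p = 2 h + 1, among the p odd numbers strictly between 2 i p and
   (2 i + 2) p only (2 i + 1) p is a multiple of p. *)
Lemma logn_u_mul (h m : nat) : prime (2 * h + 1) ->
  logn (2 * h + 1) (u (2 * (m * (2 * h + 1)))) =
  (m + logn (2 * h + 1) (u (2 * m)))%N.
Proof.
set p := (2 * h + 1)%N => pp.
have -> : (m + logn p (u (2 * m)) =
           \sum_(0 <= i < m) (1 + logn p (2 * i + 1)))%N.
  by rewrite logn_u_double big_split sum_nat_const_nat subn0 muln1.
rewrite logn_u_double big_nat_mul; apply: eq_bigr => i _.
have -> : (i * p = 0 + i * p)%N by [].
rewrite mulSn big_addn addnK big_mkord.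
have hp : (h < p)%N by rewrite /p; lia.
rewrite (bigD1 (Ordinal hp)) //= big1 => [|j /eqP hj].
  have -> : (2 * (h + i * p) + 1 = p * (2 * i + 1))%N by rewrite /p; ring.
  by rewrite lognM ?(prime_gt0 pp) ?addn1 // logn_prime // eqxx addn0.
rewrite lognE pp /=; case: ifP => // /andP[_ /dvdnP[q hq]].
case: hj; apply: val_inj => /=.
have := ltn_ord j; rewrite /p in hq * => jp.
have hq' : (2 * j + 1 = (q - 2 * i) * (2 * h + 1))%N.
  by rewrite mulnBl -hq mulnDr addnAC mulnA addnK.
have q1 : (q - 2 * i = 1)%N by nia.
by rewrite q1 in hq'; lia.
Qed.

(** Strong induction: with p = 2 h + 1 and m the quotient of n by p, rounding n + 1 up to (m + 1) p
    bounds the valuation by m + 1 plus that of U_m. *)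
Lemma logn_u_le (h n : nat) : prime (2 * h + 1) ->
  (h * logn (2 * h + 1) (u (2 * n + 2)) <= n)%N.
Proof.
move=> pp; have h0 : (0 < h)%N by case: h pp.
have mono a b : (a <= b)%N ->
    (logn (2 * h + 1) (u (2 * a)) <= logn (2 * h + 1) (u (2 * b)))%N.
  by move=> ab; rewrite !logn_u_double (big_cat_nat (leq0n a) ab) leq_addr.
elim/ltn_ind: n => n IH.
have -> : (2 * n + 2 = 2 * n.+1)%N by lia.
have [nh|hn] := ltnP n h.
  rewrite logn_u_double big_nat big1 ?muln0 // => i /andP[_ hi].
  rewrite lognE; case: ifP => // /and3P[_ _ /dvdn_leq].
  by move=> /(_ ltac:(lia)); lia.
have := divn_eq n (2 * h + 1); have := ltn_pmod n (isT : 0 < (2 * h).+1)%N.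
rewrite -addn1; set m := (n %/ _)%N; set r := (n %% _)%N => rp nE.
have le1 : (n.+1 <= m.+1 * (2 * h + 1))%N by lia.
have := mono _ _ le1; rewrite logn_u_mul // => le2.
have [m0|m0] := posnP m.
  have l1 : logn (2 * h + 1) (u (2 * 1)) = 0%N.
    by rewrite logn_u_double big_nat1 logn1.
  by rewrite m0 l1 in le2; nia.
have mn : (m < n)%N by nia.
have := IH _ mn.
have -> : (2 * m + 2 = 2 * m.+1)%N by lia.
by nia.
Qed.

(** * The lattice L modulo the quartic *)

Definition term (j : nat) : {poly rat} :=
  (u (2 * j + 2))%:R^-1 *: 'X^(2 * j).

(** The indices 0 and n are left out because their coefficients in [f] are prescribed. *)
Definition in_span (n : nat) (P : {poly rat}) :=
  exists a : nat -> int,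
    quartic %| P - \sum_(1 <= j < n) (a j)%:~R *: term j.

Lemma in_span_eqmod (n : nat) (P Q : {poly rat}) :
  quartic %| P - Q -> in_span n Q -> in_span n P.
Proof.
move=> PQ [a Qa]; exists a; have := dvdp_add PQ Qa.
by rewrite addrA subrK.
Qed.

Lemma in_spanD (n : nat) (P Q : {poly rat}) :
  in_span n P -> in_span n Q -> in_span n (P + Q).
Proof.
move=> [a Pa] [b Qb]; exists (fun j => a j + b j); have := dvdp_add Pa Qb.
rewrite addrACA -opprD -big_split /=.
by under eq_bigr => j _ do rewrite -scalerDl -intrD.
Qed.

Lemma in_spanZ (n : nat) (c : int) (P : {poly rat}) :
  in_span n P -> in_span n (c%:~R *: P).
Proof.
move=> [a Pa]; exists (fun j => c * a j).
have : quartic %| c%:~R *: (P - \sum_(1 <= j < n) (a j)%:~R *: term j).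
  by rewrite -mul_polyC dvdp_mull.
rewrite scalerBr scaler_sumr.
by under eq_bigr => j _ do rewrite scalerA -intrM.
Qed.

Lemma in_span_term (n j : nat) : (0 < j < n)%N -> in_span n (term j).
Proof.
move=> hj; exists (fun i => (i == j)%:Z).
rewrite (bigD1_seq j) ?mem_index_iota ?iota_uniq //= eqxx scale1r.
by rewrite big1 ?addr0 ?subrr ?dvdp0 // => i /negPf ->; rewrite scale0r.
Qed.

(** * Powers of t = x^2 modulo the quartic *)

Lemma term_recurrence (m : nat) :
  quartic %| 'X^(2 * m.+2) - (5 *: 'X^(2 * m.+1) + 15 *: 'X^(2 * m)).
Proof.
apply/dvdpP; exists 'X^(2 * m); rewrite /quartic.
have -> : (2 * m.+2 = 2 * m + 4)%N by lia.
have -> : (2 * m.+1 = 2 * m + 2)%N by lia.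
rewrite !exprD -!mul_polyC !rmorph_nat; ring.
Qed.

Lemma in_span1 (n : nat) : (2 < n)%N -> in_span n 1.
Proof.
move=> hn.
(* [term 2] is t^2 / 15 and [term 1] is t / 3; both are available since n > 2. *)
apply: (@in_span_eqmod _ _
  ((1 : int)%:~R *: term 2 + (-1 : int)%:~R *: term 1)).
  have := term_recurrence 0.
  have u4 : u (2 * 1 + 2) = 3%N by rewrite /u unlock.
  have u6 : u (2 * 2 + 2) = 15%N by rewrite /u unlock.
  rewrite /term u4 u6 !muln0 expr0.
  rewrite -dvdpNr -(@dvdpZr _ (15%:R^-1)) ?invr_eq0 ?pnatr_eq0 //.
  rewrite (_ : _ *: _ = 1 - (1%:~R *: (15%:R^-1 *: 'X^(2 * 2)) +
    (-1)%:~R *: (3%:R^-1 *: 'X^(2 * 1)))) //.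
  by apply/polyP => i; rewrite !coefE; field.
apply: in_spanD; apply: in_spanZ; apply: in_span_term; lia.
Qed.

(* The pair (A_m, B_m) of the header. *)
Fixpoint pow_coef (m : nat) : int * int :=
  if m is m'.+1 then
    let: (A, B) := pow_coef m' in (5 * A + B, 15 * A)
  else (0, 1).

Lemma pow_coef1S (m : nat) :
  (pow_coef m.+1).1 = 5 * (pow_coef m).1 + (pow_coef m).2.
Proof. by rewrite /=; case: (pow_coef m). Qed.

Lemma pow_coef2S (m : nat) : (pow_coef m.+1).2 = 15 * (pow_coef m).1.
Proof. by rewrite /=; case: (pow_coef m). Qed.

Lemma pow_coefP (m : nat) :
  quartic %| 'X^(2 * m) -
    ((pow_coef m).1%:~R *: 'X^2 + ((pow_coef m).2)%:~R *: 1).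
Proof.
elim: m => [|m IH]; first by rewrite scale0r add0r scale1r subrr dvdp0.
rewrite pow_coef1S pow_coef2S intrD !intrM.
have := dvdp_mulr 'X^2 IH.
have := dvdp_mulr ((pow_coef m).1%:~R%:P) (term_recurrence 0).
move=> h1 h2; have := dvdp_add h2 h1.
rewrite [in 'X^(2 * m.+1)]mulnS [in 'X^(2 + _)]exprD; congr (_ %| _).
rewrite -!mul_polyC polyCD !polyCM !(rmorph_nat intr) !rmorph_nat.
ring.
Qed.

(** One step of [pow_coef] is a linear map of determinant -15, the norm of t. *)
Lemma pow_coef_det (m : nat) :
  (pow_coef m).1 * (pow_coef m.+1).2 - (pow_coef m.+1).1 * (pow_coef m).2 =
  - (-15) ^+ m.
Proof.
elim: m => [//|m IH].
have -> : - (-15) ^+ m.+1 = -15 * - (-15) ^+ m :> int by rewrite exprS; ring.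
rewrite -IH !pow_coef1S !pow_coef2S pow_coef1S; ring.
Qed.

(** From index 1 on, 3 divides B, so modulo 3 each step multiplies A by 5, starting at A_1 = 1. *)
Lemma pow_coef1_ndvd3 (m : nat) : ~~ (3 %| (pow_coef m.+1).1)%Z.
Proof.
suff [//] : ~~ (3 %| (pow_coef m.+1).1)%Z /\ (3 %| (pow_coef m.+1).2)%Z.
elim: m => [//|m [h1 h2]].
rewrite (pow_coef1S m.+1) (pow_coef2S m.+1).
by split; [rewrite rpredDr // Gauss_dvdzr | apply: dvdz_mulr].
Qed.

(** Two steps gain a factor 5, as t^2 = 5 (t + 3). *)
Lemma pow_coef_dvd5 (m : nat) :
  (5 ^+ m./2 %| (pow_coef m).1)%Z /\ (5 ^+ m./2 %| (pow_coef m).2)%Z.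
Proof.
elim/ltn_ind: m => -[|[|m]] IH; rewrite ?dvd1z //.
have [/dvdzP[q hq] /dvdzP[r hr]] := IH m (leqW (leqnn _)).
rewrite [m.+2./2]/= exprS !pow_coef1S !pow_coef2S pow_coef1S hq hr.
split; apply/dvdzP.
  by exists (5 * q + r + 3 * q); ring.
by exists (3 * (5 * q + r)); ring.
Qed.

(** * Elements of the ideal I *)

Lemma in_spanZ_coprime (n : nat) (a b c : int) (P : {poly rat}) :
  coprimez a b -> in_span n ((c * a)%:~R *: P) ->
  in_span n ((c * b)%:~R *: P) -> in_span n (c%:~R *: P).
Proof.
move=> /coprimezP[[x y] /= xy] /(in_spanZ n x) h1 /(in_spanZ n y) h2.
have := in_spanD _ _ _ h1 h2; rewrite !scalerA -scalerDl -!intrM -intrD.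
by rewrite (_ : _ + _ = c) // -[RHS]mulr1 -xy; ring.
Qed.

Lemma u_neq0 (j : nat) : (u (2 * j + 2))%:R != 0 :> rat.
Proof.
have -> : (2 * j + 2 = 2 * j.+1)%N by lia.
by rewrite pnatr_eq0 -lt0n u_double_gt0.
Qed.

(** Since U_n = U_{n-2} (2 n - 1) (2 n + 1), dividing t^n = 5 t^{n-1} + 15 t^{n-2} by U_{n-2} leaves
    integral coefficients on the terms. *)
Lemma term_coef_recurrence (n : nat) : (2 < n)%N ->
  in_span n (((2 * n%:Z + 1) * (2 * n%:Z - 1))%:~R *: term n).
Proof.
case: n => [|[|m]] // hm.
apply: (@in_span_eqmod _ _ ((5 * (2 * m + 3)%N%:Z)%:~R *: term m.+1 +
                            (15 : int)%:~R *: term m)); last first.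
  by apply: in_spanD; apply: in_spanZ; apply: in_span_term; lia.
have := term_recurrence m.
rewrite -(@dvdpZr _ (u (2 * m + 2))%:R^-1) ?invr_eq0 ?u_neq0 //.
congr (_ %| _); have := u_neq0 m.
rewrite /term !u_doubleSS !natrM => h; rewrite !scalerBr scalerDr !scalerA.
have h3 : (2 * m + 3)%:R != 0 :> rat by rewrite pnatr_eq0; lia.
have h5 : (2 * m.+1 + 3)%:R != 0 :> rat by rewrite pnatr_eq0; lia.
congr (_ *: _ - (_ *: _ + _ *: _)).
- have -> : (2 * m.+2%:Z + 1) * (2 * m.+2%:Z - 1) =
            ((2 * m + 3) * (2 * m.+1 + 3))%N%:Z :> int by lia.
  rewrite -pmulrn natrM.
  by move: _%:R (_ + 3)%:R (_ + 3)%:R h h3 h5 => x y z *; field; apply/and3P.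
- rewrite intrM -pmulrn.
  by move: _%:R (_ + 3)%:R h h3 => x y *; field; apply/andP.
- by rewrite mulrC.
Qed.

Lemma term_coef_coprime5 (n : nat) : (2 < n)%N ->
  exists2 c : int, coprimez 5 c & in_span n (c%:~R *: term n).
Proof.
move=> hn.
have u0 : (0 < u (2 * n + 2))%N by rewrite lt0n -(pnatr_eq0 rat) u_neq0.
have [r cr ur] := pfactor_coprime (isT : prime 5) u0.
have := @logn_u_le 2 n isT; move: ur; rewrite [(2 * 2 + 1)%N]/=.
set s := logn 5 _ => ur sn.
have s2 : (s <= n./2)%N by lia.
have d5 : ((5 : int) ^+ s %| (5 : int) ^+ n./2)%Z by rewrite dvdz_exp2l.
have [/(dvdz_trans d5)/dvdzP[A hA] /(dvdz_trans d5)/dvdzP[B hB]] :=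
  pow_coef_dvd5 n.
have f0 : (5%:R : rat) ^+ s != 0 by rewrite expf_eq0 pnatr_eq0 andbF.
have r0 : r%:R != 0 :> rat.
  by rewrite pnatr_eq0; apply: contraTneq u0 => r0; rewrite ur r0.
(* As U_n = r 5^s, r times [term n] is t^n / 5^s, an integral combination of t = 3 [term 1] and
   1. *)
exists r%:Z; first by rewrite coprimezE.
apply: (@in_span_eqmod _ _ ((3 * A)%:~R *: term 1 + B%:~R *: 1)); last first.
  apply: in_spanD; apply: in_spanZ; first by apply: in_span_term; lia.
  exact: in_span1.
have := pow_coefP n.
rewrite -(@dvdpZr _ (5%:R ^- s)) ?invr_eq0 //.
congr (_ %| _); rewrite hA hB /term ur.
have -> : u (2 * 1 + 2) = 3%N by rewrite /u unlock.
rewrite scalerBr scalerDr !scalerA natrM natrX !intrM !rmorphXn /= -!pmulrn.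
congr (_ *: _ - (_ *: _ + _ *: _)); field; rewrite ?f0 ?r0 //.
Qed.

Lemma term_coef_coprime3 (n : nat) : (2 < n)%N -> ~~ (3 %| 2 * n + 1)%N ->
  exists2 c : int, coprimez 3 c & in_span n (c%:~R *: term n).
Proof.
case: n => [|[|m]] // hm hn3.
have u0 : (0 < u (2 * m.+1 + 2))%N by rewrite lt0n -(pnatr_eq0 rat) u_neq0.
have [r cr ur] := pfactor_coprime (isT : prime 3) u0.
have := @logn_u_le 1 m.+1 isT; move: ur; rewrite [(2 * 1 + 1)%N]/= mul1n.
set t := logn 3 _ => ur tn.
have /dvdzP[q hq] : ((3 : int) ^+ t %| (-15 : int) ^+ m.+1)%Z.
  rewrite (_ : (-15 : int) = 3 * -5) // exprMn dvdz_mulr //.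
  by rewrite dvdz_exp2l.
have f0 : (3%:R : rat) ^+ t != 0 by rewrite expf_eq0 pnatr_eq0 andbF.
have r0 : r%:R != 0 :> rat.
  by rewrite pnatr_eq0; apply: contraTneq u0 => r0; rewrite ur r0.
have n0 : (2 * m.+1 + 3)%:R != 0 :> rat by rewrite pnatr_eq0; lia.
set A := (pow_coef m.+1).1; set A' := (pow_coef m.+2).1.
(* With n = m + 2 and U_{n-1} = r 3^t (this t being the exponent), U_n = U_{n-1} (2 n + 1), so this
   multiple of [term n] is A x^(2n) / 3^t. *)
exists (A * (r * (2 * m.+1 + 3))%N%:Z).
  rewrite coprimezMr !coprimezE /= coprimeMr cr !prime_coprime //=.
  by have := pow_coef1_ndvd3 m; rewrite -/A; lia.
(* Eliminating x^2 between the reductions of x^(2n) and x^(2n-2) gives A x^(2n) - A' x^(2n-2) = -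
   (-15)^(n-1) = - q 3^t. *)
apply: (@in_span_eqmod _ _
  ((A' * r%:Z)%:~R *: term m.+1 + (- q)%:~R *: 1)); last first.
  apply: in_spanD; apply: in_spanZ; first by apply: in_span_term; lia.
  exact: in_span1.
have h1 := dvdp_mull (A%:~R)%:P (pow_coefP m.+2).
have h2 := dvdp_mull (A'%:~R)%:P (pow_coefP m.+1).
have := dvdp_sub h1 h2.
rewrite -(@dvdpZr _ (3%:R ^- t)) ?invr_eq0 //.
congr (_ %| _).
have := pow_coef_det m.+1; rewrite -/A -/A' hq.
set B := (pow_coef m.+1).2; set B' := (pow_coef m.+2).2 => det.
rewrite [term m.+2]/term u_doubleSS [term m.+1]/term ur.
have {}hq : q%:~R * 3%:R ^+ t = A'%:~R * B%:~R - A%:~R * B'%:~R :> rat.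
  by rewrite -!intrM -intrB -opprB det opprK intrM rmorphXn.
have {hq} qE : q%:~R = (A'%:~R * B%:~R - A%:~R * B'%:~R) / 3%:R ^+ t :> rat.
  by rewrite -hq mulfK.
rewrite !intrM intrN qE -!pmulrn !natrM natrX.
apply/polyP => i; rewrite !(coefD, coefN, coefZ, coefCM).
move: ((3%:R : rat) ^+ t) (r%:R : rat) ((2 * m.+1 + 3)%:R : rat) f0 r0 n0.
move=> x y z f0 r0 n0.
field; apply/and3P; split => //.
Qed.

(** * The arithmetic hypothesis on k' and k'' *)

(** If 3 divides 2 n + 1, then all factors 3 come from it and k' (2 n - 1) = k'' 5^v', so 5^v' > 2 n
    - 1. But 5 divides at most one of 2 n - 1 and 2 n + 1, so either 5^v' divides 2 n - 1 or 3 *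
    5^v' divides 2 n + 1; both are too large. *)
Lemma ndvd3_of_lt (n k' k'' e e' v' : nat) (hn : (2 < n)%N)
  (hk' : (2 * n + 1 = k' * 3 ^ e)%N) (hk'3 : coprime k' 3)
  (hk'' : ((2 * n + 1) * (2 * n - 1) = k'' * 3 ^ e' * 5 ^ v')%N)
  (hk''15 : coprime k'' 15) (hlt : (k'' < k')%N) : ~~ (3 %| 2 * n + 1)%N.
Proof.
apply/negP => d3.
have c3 : coprime 3 (2 * n - 1).
  rewrite prime_coprime //; apply/negP => d3'; lia.
have c3k : coprime 3 k''.
  move: hk''15; rewrite (_ : 15 = 3 * 5)%N // coprimeMr.
  by rewrite coprime_sym => /andP[].
have c35 : coprime 3 (5 ^ v') by rewrite coprimeXr.
have eE : e = e'.
  have c3k' : coprime 3 k' by rewrite coprime_sym.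
  have := congr1 (logn 3) hk''; rewrite {1}hk'.
  rewrite -mulnA (logn_Gauss _ c3k') mulnC (logn_Gauss _ c3) pfactorK //.
  by rewrite -mulnA (logn_Gauss _ c3k) mulnC (logn_Gauss _ c35) pfactorK.
have kE : (k' * (2 * n - 1) = k'' * 5 ^ v')%N.
  apply/eqP; rewrite -(@eqn_pmul2r (3 ^ e)) ?expn_gt0 //; apply/eqP.
  by rewrite mulnAC -hk' hk'' eE mulnAC.
have lt5 : (2 * n - 1 < 5 ^ v')%N.
  by rewrite ltnNge; apply/negP => le5; nia.
have d5 : (5 ^ v' %| (2 * n + 1) * (2 * n - 1))%N by rewrite hk'' dvdn_mull.
have [d5n|nd5n] := boolP (5 %| 2 * n - 1)%N.
  have : (5 ^ v' %| 2 * n - 1)%N.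
    rewrite -(@Gauss_dvdr _ (2 * n + 1)) // coprimeXl // prime_coprime //; lia.
  by move=> /dvdn_leq; lia.
have : (3 * 5 ^ v' %| 2 * n + 1)%N.
  rewrite Gauss_dvd // d3 /= -(@Gauss_dvdl _ _ (2 * n - 1)) //.
  by rewrite coprimeXl // prime_coprime.
by move=> /dvdn_leq; lia.
Qed.

(** * Choice of the coefficients *)

Lemma f_term (n : nat) (a : nat -> int) :
  f n a = \sum_(0 <= j < n.+1) (a j)%:~R *: term j.
Proof. by rewrite big_mkord; apply: eq_bigr => j _; rewrite /term scalerA. Qed.

Lemma term0 : term 0 = 1.
Proof. by rewrite /term muln0 /u unlock /= invr1 scale1r. Qed.

Theorem mainTheorem3 (n : nat) (k' k'' : int) (e e' v' : nat)
  (hn : (2 < n)%N)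
  (hk' : 2 * n%:Z + 1 = k' * 3 ^+ e)
  (hk'3 : gcdz k' 3 = 1)
  (hk'' : (2 * n%:Z + 1) * (2 * n%:Z - 1) = k'' * 3 ^+ e' * 5 ^+ v')
  (hk''15 : gcdz k'' 15 = 1)
  (hlt : k'' < k') :
  irreducible_poly quartic /\
  exists a : nat -> int,
    [/\ a n = k'', a 0%N = 1 & quartic %| f n a].
Proof.
split; first exact: quartic_irreducible.
have hn3 : ~~ (3 %| 2 * n + 1)%N.
  have k'_gt0 : 0 < k'.
    by rewrite -(@pmulr_lgt0 _ (3 ^+ e)) ?exprn_gt0 // -hk'; lia.
  have k''_gt0 : 0 < k''.
    have pos : 0 < 3 ^+ e' * 5 ^+ v' :> int by rewrite mulr_gt0 ?exprn_gt0.
    by rewrite -(pmulr_lgt0 _ pos) mulrA -hk'' mulr_gt0 //; lia.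
  case: k' k'_gt0 hk' hk'3 hlt => // k' _ hk' [hk'3].
  case: k'' k''_gt0 hk'' hk''15 => // k'' _ hk'' [hk''15] hlt.
  apply: (@ndvd3_of_lt n k' k'' e e' v') => //; try exact/eqP.
    by apply/eqP; rewrite -eqz_nat PoszM -(natz (3 ^ e)) natrX -hk'; lia.
  apply/eqP; rewrite -eqz_nat !PoszM -(natz (3 ^ e')) -(natz (5 ^ v')).
  by rewrite !natrX -hk''; lia.
have [c3 cop3 h3] := term_coef_coprime3 n hn hn3.
have [c5 cop5 h5] := term_coef_coprime5 n hn.
have h := term_coef_recurrence n hn; rewrite hk'' in h.
(* The powers of 5 and then of 3 are stripped from the multiplier by Bezout, against [c5] and
   [c3]. *)
have {}h : in_span n ((k'' * 3 ^+ e')%:~R *: term n).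
  apply: (@in_spanZ_coprime _ (5 ^+ v') c5) => //; first by rewrite coprimezXl.
  by rewrite intrM -scalerA; apply: in_spanZ.
have {}h : in_span n (k''%:~R *: term n).
  apply: (@in_spanZ_coprime _ (3 ^+ e') c3) => //; first by rewrite coprimezXl.
  by rewrite intrM -scalerA; apply: in_spanZ.
have [a ha] := in_spanD _ _ _ (in_span1 n hn) h.
(* The middle coefficients change sign because [a] expresses 1 + k'' [term n] itself in the span. *)
exists (fun j => if j == 0%N then 1 else if j == n then k'' else - a j).
split; [by rewrite eqxx; case: n hn {h hn3 h3 h5 hk' hk'' ha} | by [] |].
apply: etrans ha; congr (_ %| _).
case: n hn {hn3 h3 h5 hk' hk'' h} => // n _.
rewrite f_term big_ltn // big_nat_recr //= eqxx term0 scale1r.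
rewrite addrA addrAC; congr (_ + _); rewrite -sumrN.
apply: eq_big_nat => j /andP[j0 jn].
by rewrite gtn_eqF // ltn_eqF // rmorphN scaleNr.
Qed.
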